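(* There exist a nonnegative function $w\in L^1(\mathbb{T})$ with $w^{-1}\in L^\infty(\mathbb{T})$ and a function $f$ in the separable Banach function space $$X=L^1(w)=\{f\in L^0: fw\in L^1(\mathbb{T})\},\qquad \|f\|_X=\|fw\|_{L^1},$$ such that the relation $$\lim_{n\to\infty}\|f*F_n-f\|_X=0$$ is not fulfilled, where $F_n$ is the $n$-th Fejér kernel.
   Context: $\mathbb{T}=\{z\in\mathbb{C}:|z|=1\}$ is the unit circle with normalized Lebesgue measure $dm(t)=|dt|/(2\pi)$; $L^p=L^p(\mathbb{T})$ are the Lebesgue spaces with respect to $m$. $L^0$ is the space of measurable complex-valued functions on $\mathbb{T}$ (functions equal a.e. are identified), and $L^0_+$ is the set of measurable functions on $\mathbb{T}$ with values in $[0,\infty]$. Banach function space: a mapping $\rho:L^0_+\to[0,\infty]$ is a Banach function norm if for all $f,g,f_n\in L^0_+$ ($n\in\mathbb{N}$), all constants $a\ge 0$ and all measurable $E\subset\mathbb{T}$: (A1) $\rho(f)=0\Leftrightarrow f=0$ a.e., $\rho(af)=a\rho(f)$, $\rho(f+g)\le\rho(f)+\rho(g)$; (A2) $0\le g\le f$ a.e. implies $\rho(g)\le\rho(f)$; (A3) $0\le f_n\uparrow f$ a.e. implies $\rho(f_n)\uparrow\rho(f)$; (A4) $m(E)<\infty$ implies $\rho(\chi_E)<\infty$; (A5) $\int_E f\,dm\le C_E\,\rho(f)$ with a constant $C_E\in(0,\infty)$ that may depend on $E$ and $\rho$ but not on $f$. The set $X=\{f\in L^0:\rho(|f|)<\infty\}$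 with norm $\|f\|_X=\rho(|f|)$ is called a Banach function space. ''Separable'' means separable as a normed space. Convolution: $(f*g)(e^{i\theta})=\frac{1}{2\pi}\int_{-\pi}^{\pi}f(e^{i\theta-i\varphi})g(e^{i\varphi})\,d\varphi$ for $f,g\in L^1$. Fejér kernel: for $n\in\mathbb{N}$, $$F_n(e^{i\theta})=\sum_{k=-n}^n\left(1-\frac{|k|}{n+1}\right)e^{i\theta k}.$$ *)

(* Defs.v *)
From HB Require Import structures.
From mathcomp Require Import all_boot all_order all_algebra.
From mathcomp Require Import complex.
From mathcomp Require Import all_classical all_reals all_analysis.
From mathcomp Require Import measurable_realfun.

Set Implicit Arguments.
Unset Strict Implicit.
Unset Printing Implicit Defensive.

Import Order.TTheory GRing.Theory Num.Theory.
Import numFieldNormedType.Exports.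

Local Open Scope classical_set_scope.
Local Open Scope ring_scope.

Record circle (R : realType) := Circle {
  circle_val :> R[i];
  circle_valP : `|circle_val| == 1 }.

HB.instance Definition _ (R : realType) :=
  [isSub for @circle_val R].
HB.instance Definition _ (R : realType) := [Choice of circle R by <:].

Section circle_operations.
Context {R : realType}.

Lemma circle1_subproof : `|1 : R[i]| == 1.
Proof. by rewrite normr1. Qed.

Definition circle1 : circle R := Circle circle1_subproof.

Lemma circleM_subproof (z t : circle R) :
  `|(z : R[i]) * (t : R[i])| == 1.
Proof.
by rewrite normrM (eqP (circle_valP z)) (eqP (circle_valP t)) mulr1.
Qed.

Definition circleM (z t : circle R) : circle R := Circle (circleM_subproof z t).

Lemma expi_subproof (theta : R) :
  `|Complex (cos theta) (sin theta)| == 1.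
Proof. by rewrite normc_def /= cos2Dsin2 sqrtr1. Qed.

(* e^(i theta) *)
Definition expi (theta : R) : circle R := Circle (expi_subproof theta).

Lemma expiD (theta phi : R) :
  expi (theta + phi) = circleM (expi theta) (expi phi).
Proof.
apply: val_inj => /=.
by rewrite cosD sinD; congr Complex; exact: addrC.
Qed.

End circle_operations.

HB.instance Definition _ (R : realType) := isPointed.Build (circle R) circle1.

(* A subset of the circle is measurable when its preimage under
   theta |-> e^(i theta) is a Borel subset of the line.  This is the Borel
   sigma-algebra of the circle, as theta |-> e^(i theta) is continuous and has
   a Borel right inverse, the argument. *)
Fact circle_display : measure_display.
Proof. exact: default_measure_display. Qed.

Section circle_measurable.
Context {R : realType}.

Definition circle_measurable : set (set (circle R)) :=
  image_set_system setT (expi : measurableTypeR R -> circle R) measurable.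

Let circle_sigma_algebra : sigma_algebra setT circle_measurable.
Proof.
exact: (@sigma_algebra_image _ _ setT _ _ (sigma_algebra_measurable _)).
Qed.

Let circle_measurable0 : circle_measurable set0.
Proof. by case: circle_sigma_algebra. Qed.

Let circle_measurableC A : circle_measurable A -> circle_measurable (~` A).
Proof. by case: circle_sigma_algebra => _ + _ => /[apply]; rewrite setTD. Qed.

Let circle_measurable_bigcup (F : (set (circle R))^nat) :
  (forall i, circle_measurable (F i)) -> circle_measurable (\bigcup_i F i).
Proof. by case: circle_sigma_algebra => _ _; apply. Qed.

HB.instance Definition _ := isMeasurable.Build circle_display (circle R)
  circle_measurable0 circle_measurableC circle_measurable_bigcup.

Lemma measurable_expi :
  measurable_fun setT (expi : measurableTypeR R -> circle R).
Proof. by move=> _ A. Qed.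

HB.instance Definition _ := isMeasurableFun.Build _ _ _ _
  (expi : measurableTypeR R -> circle R) measurable_expi.

End circle_measurable.

Section circle_measure.
Context (R : realType).

Lemma ltNpipi : - pi < pi :> R.
Proof. by rewrite gt0_cp// pi_gt0. Qed.

(* normalized Lebesgue measure |dt| / (2 pi): the image of the uniform
   probability on [-pi, pi] under theta |-> e^(i theta) *)
Definition circle_measure : probability (circle R) R :=
  distribution (uniform_prob ltNpipi)
    (expi : measurableTypeR R -> circle R).

End circle_measure.

Section function_spaces.
Context {R : realType}.
Notation T := (circle R).
Notation m := (circle_measure R).
Implicit Types f g : T -> \bar R.

Local Open Scope ereal_scope.

(* Functions are not quotiented by a.e. equality: L0, L1 and the spaces below
   are sets of representatives, and their "norms" vanish on null functions. *)

Definition cmod (f : T -> R[i]) : T -> \bar R :=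
  fun t => (ComplexField.Normc.normc (f t))%:E.

Definition L0 : set (T -> R[i]) :=
  [set f : T -> R[i] | measurable_fun setT (@complex.Re R \o f) /\
    measurable_fun setT (@complex.Im R \o f)].

Definition L0_plus : set (T -> \bar R) :=
  [set f : T -> \bar R | measurable_fun setT f /\ forall t, 0 <= f t].

Definition L1_norm (f : T -> R[i]) : \bar R := \int[m]_t cmod f t.

Definition L1 : set (T -> R[i]) :=
  [set f : T -> R[i] | L0 f /\ L1_norm f < +oo].

Record banach_function_norm (rho : (T -> \bar R) -> \bar R) : Prop := {
  bfn_ge0 : forall f, L0_plus f -> 0 <= rho f;
  bfn_eq0 : forall f, L0_plus f -> (rho f = 0 <-> {ae m, forall t, f t = 0});
  bfnZ : forall f (a : R), L0_plus f -> (0 <= a)%R ->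
    rho (fun t => a%:E * f t) = a%:E * rho f;
  bfnD : forall f g, L0_plus f -> L0_plus g ->
    rho (fun t => f t + g t) <= rho f + rho g;
  bfn_le : forall f g, L0_plus f -> L0_plus g ->
    {ae m, forall t, g t <= f t} -> rho g <= rho f;
  bfn_cvg : forall (fn : (T -> \bar R)^nat) f,
    (forall n, L0_plus (fn n)) -> L0_plus f ->
    {ae m, forall t, nondecreasing_seq (fn ^~ t) /\ fn ^~ t @ \oo --> f t} ->
    nondecreasing_seq (rho \o fn) /\ rho \o fn @ \oo --> rho f;
  bfn_indic : forall E, measurable E -> m E < +oo ->
    rho (EFin \o \1_E) < +oo;
  bfn_integral : forall E, measurable E ->
    exists C : R, (0 < C)%R /\
      forall f, L0_plus f -> \int[m]_(t in E) f t <= C%:E * rho f }.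

Definition banach_function_space
    (X : set (T -> R[i])) (normX : (T -> R[i]) -> \bar R) : Prop :=
  exists rho, [/\ banach_function_norm rho,
    X = [set f : T -> R[i] | L0 f /\ rho (cmod f) < +oo] &
    forall f : T -> R[i], X f -> normX f = rho (cmod f)].

Definition separable
    (X : set (T -> R[i])) (normX : (T -> R[i]) -> \bar R) : Prop :=
  exists D : set (T -> R[i]), [/\ countable D, D `<=` X &
    forall (f : T -> R[i]) (e : R), X f -> (0 < e)%R ->
      exists2 g : T -> R[i], D g & normX (fun t => f t - g t)%R < e%:E].

Definition weight_mul (w : T -> R) (f : T -> R[i]) : T -> R[i] :=
  fun t => (f t * (w t)%:C%C)%R.

Definition weighted_L1 (w : T -> R) : set (T -> R[i]) :=
  [set f : T -> R[i] | L0 f /\ L1 (weight_mul w f)].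

Definition weighted_L1_norm (w : T -> R) (f : T -> R[i]) : \bar R :=
  L1_norm (weight_mul w f).

End function_spaces.

Section fejer.
Context {R : realType}.
Notation T := (circle R).

Definition cintegral d (U : measurableType d)
    (mu : {measure set U -> \bar R}) (D : set U) (h : U -> R[i]) : R[i] :=
  Complex (\int[mu]_(x in D) @complex.Re R (h x))
    (\int[mu]_(x in D) @complex.Im R (h x)).

(* e^(i theta - i phi) = e^(i theta) * e^(- i phi) *)
Definition convolution (f g : T -> R[i]) : T -> R[i] := fun z =>
  ((2 * pi)^-1)%:C%C *
  cintegral (@lebesgue_measure R) `[- pi, pi]
    (fun phi => f (circleM z (expi (- phi))) * g (expi phi)).

(* k = j - n runs over the integers from -n to n, and e^(i theta k) = z ^ k. *)
Definition fejer (n : nat) : T -> R[i] := fun z =>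
  \sum_(j < n.*2.+1)
    (let k : int := (j : nat)%:Z - n%:Z in
     (1 - `|k|%N%:R / n.+1%:R) * (z : R[i]) ^ k).

End fejer.

(* Main.v *)
Require Import Defs.
From HB Require Import structures.
From mathcomp Require Import all_boot all_order all_algebra.
From mathcomp Require Import complex.
From mathcomp Require Import all_classical all_reals all_analysis.
From mathcomp Require Import measurable_realfun ess_sup_inf.
From mathcomp Require Import ring lra.

(** The counterexample places two inverse-square-root singularities on the two
    sides of the point 1 of the circle.  In terms of the argument x, with values
    in ]-pi, pi], let f (x) = x ^ (- 1/2) for x > 0 and f (x) = 0 for x <= 0,
    and let w (x) = 1 + (- x) ^ (- 1/2) for x < 0 and w (x) = 1 for x >= 0.
    Then w is integrable and at least 1, and f w = f is integrable, because w
    exceeds 1 only where f vanishes.  Convolution with F_n smears f over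
    the negative side at scale 1 / n: F_n is nonnegative, and it is at least
    (n + 1) / 4 on an arc of length comparable with d = pi / (8 (n + 1))
    ([fejerR_ge]).  For - d < x < 0 the values of f on ]0, d[ alone give
    (f * F_n) (x) >= d ^ (- 1/2) / 64 ([Re_convolution_one_sided_fun_ge]), while
    w (x) >= d ^ (- 1/2).  As f vanishes there, and the arc has measure
    d / (2 pi), the norm of f * F_n - f in L^1(w) is at least 1 / (128 pi) for
    every n ([weighted_L1_norm_convolution_sub_ge]), and does not tend to 0.

    The properties of the kernel come from the identity
    (n + 1) F_n (z) = |1 + z + ... + z ^ n| ^ 2 on the circle
    ([fejer_sqr_norm]).  The space L^1(w) is a Banach function space for any
    integrable w >= 1 ([banach_function_space_weighted_L1]): the axioms are
    those of the integral against the measure w dm, where integrability of w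
    makes the norms of indicators finite, and w >= 1 bounds integrals over
    measurable sets by the norm.  It is separable for any positive w
    ([separable_weighted_L1]), because multiplication by w is an isometry onto
    L^1, where step functions of the argument with rational data are dense. *)

Import Order.TTheory GRing.Theory Num.Theory.
Import numFieldNormedType.Exports.

Local Open Scope classical_set_scope.
Local Open Scope ring_scope.

(** * The argument of a point of the circle *)

(** The principal argument, with values in ]-pi, pi]. *)
Definition arg {R : realType} (z : circle R) : R :=
  if 0 <= @complex.Im R z then acos (@complex.Re R z)
  else - acos (@complex.Re R z).

Section argument.
Context {R : realType}.
Implicit Types (z : circle R) (x : R).

Lemma circle_Re2DIm2 z : @complex.Re R z ^+ 2 + @complex.Im R z ^+ 2 = 1.
Proof.
have := circle_valP z; rewrite normc_def => /eqP[] h.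
rewrite -[LHS]sqr_sqrtr ?addr_ge0 ?sqr_ge0//.
by rewrite h expr1n.
Qed.

Lemma circle_Re_itv z : -1 <= @complex.Re R z <= 1.
Proof.
rewrite -ler_norml -(@ler_pXn2r _ 2)// ?nnegrE// expr1n real_normK ?num_real//.
by rewrite -(circle_Re2DIm2 z) lerDl sqr_ge0.
Qed.

Lemma expi_arg z : expi (arg z) = z.
Proof.
have := circle_Re2DIm2 z; have := circle_Re_itv z.
case: z => -[a b] ab1 /= aitv ab; apply: val_inj; rewrite /arg/=.
have ab' : b ^+ 2 = 1 - a ^+ 2 by rewrite -ab addrAC subrr add0r.
case: ifPn => b0.
  by rewrite acosK ?in_itv//= sin_acos// -ab' sqrtr_sqr ger0_norm.
rewrite cosN sinN acosK ?in_itv//= sin_acos// -ab' sqrtr_sqr ltr0_norm ?opprK//.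
by rewrite ltNge.
Qed.

Lemma arg_expi x : - pi < x <= pi -> arg (expi x) = x.
Proof.
move=> /andP[Npix xpi]; rewrite /arg/=.
have [x0|x0] := leP 0 x.
  by rewrite sin_ge0_pi ?x0//= cosK// in_itv/= x0.
rewrite leNgt -oppr_gt0 -sinN sin_gt0_pi/=; last first.
  by rewrite oppr_gt0 x0/= ltrNl.
by rewrite cosKN ?opprK// (ltW x0) (ltW Npix).
Qed.

Lemma measurable_acos : measurable_fun `[(-1 : R), 1] (@acos R).
Proof.
apply: (@measurable_fun_itv_cc _ _ _ false true).
apply: open_continuous_measurable_fun.
  exact: interval_open.
by move=> x; rewrite inE/= in_itv/= => x11; exact: continuous_acos.
Qed.

(** A function on the circle is measurable as soon as it is measurable as a
    function of the angle. *)
Lemma measurable_circle d (U : measurableType d) (g : circle R -> U) :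
  measurable_fun setT (g \o expi : measurableTypeR R -> U) <->
  measurable_fun setT g.
Proof.
split=> mg; last exact: (measurableT_comp mg measurable_expi).
move=> _ A mA; rewrite setTI; have := mg measurableT A mA.
by rewrite /measurable/= /circle_measurable /image_set_system/=.
Qed.

Lemma measurable_arg : measurable_fun setT (@arg R).
Proof.
apply/measurable_circle.
have macoscos : measurable_fun setT (fun x : R => acos (cos x)).
  apply: (@measurable_comp _ _ _ _ _ _ `[(-1 : R), 1]%classic) => //.
  - by move=> _ [x _ <-] /=; rewrite in_itv/= cos_geN1 cos_le1.
  - exact: measurable_acos.
  - by apply: continuous_measurable_fun; exact: continuous_cos.
rewrite /arg/comp/=; apply: measurable_fun_ifT => //=.
  apply: measurable_fun_ler => //.
  by apply: continuous_measurable_fun; exact: continuous_sin.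
exact: measurableT_comp.
Qed.

Local Open Scope ereal_scope.

Lemma ge0_integral_circle (g : circle R -> \bar R) :
  measurable_fun setT g -> (forall z, 0 <= g z) ->
  \int[circle_measure R]_z g z =
  ((2 * pi)^-1)%:E *
  \int[@lebesgue_measure R]_(x in `[(- pi)%R, pi]) g (expi x).
Proof.
move=> mg g0; rewrite ge0_integral_distribution// integral_uniform//=.
  by rewrite opprK -mulr2n mulr_natl.
exact: (measurableT_comp mg measurable_expi).
Qed.

(** The integral over the circle of a function of the argument; the endpoint
    - pi, where arg (expi (- pi)) = pi, carries no mass. *)
Lemma ge0_integral_circle_arg (G : R -> \bar R) :
  measurable_fun setT G -> (forall x, 0 <= G x) ->
  \int[circle_measure R]_z G (arg z) =
  ((2 * pi)^-1)%:E * \int[@lebesgue_measure R]_(x in `[(- pi)%R, pi]) G x.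
Proof.
move=> mG G0; rewrite ge0_integral_circle//; last first.
  by apply: measurableT_comp => //; exact: measurable_arg.
congr (_ * _); rewrite -!integral_itv_obnd_cbnd//.
- by apply: eq_integral => x; rewrite inE/= in_itv/= => /arg_expi ->.
- exact: measurable_funTS.
- apply: measurable_funTS.
  have mGarg := measurableT_comp mG measurable_arg.
  by have /measurable_circle := mGarg.
Qed.

End argument.

(** * Integrals on the line *)

Section reflection.
Context {R : realType}.
Local Notation mu := (@lebesgue_measure R).
Local Open Scope ereal_scope.

(** The reflection of the line that exchanges 0 and c. *)
Definition reflect_line (c : R) : measurableTypeR R -> measurableTypeR R :=
  fun x => (c - x)%R.

Lemma measurable_reflect_line c : measurable_fun setT (reflect_line c).
Proof. exact: measurable_funB. Qed.

HB.instance Definition _ c := isMeasurableFun.Build _ _ _ _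
  (reflect_line c) (measurable_reflect_line c).

Lemma lebesgue_measure_reflect (c : R) (A : set R) : measurable A ->
  pushforward mu (reflect_line c) A = mu A.
Proof.
move=> mA; apply/esym/lebesgue_measure_unique => //= _ [[a b]] _ <-.
rewrite /pushforward.
rewrite (_ : _ @^-1` _ = `[c - b, c - a[%classic)%R.
  rewrite !lebesgue_measure_itv/= !lte_fin ltrD2l ltrN2.
  by case: ifP => // _; rewrite -!EFinB; congr (_%:E); ring.
rewrite /reflect_line; apply/seteqP.
by split => x /=; rewrite !in_itv/= => /andP[? ?]; apply/andP; split; lra.
Qed.

Lemma ge0_integral_reflect (c a b : R) (g : R -> \bar R) :
  measurable_fun setT g -> (forall x, 0 <= g x) ->
  \int[mu]_(x in `[a, b]) g (c - x)%R =
  \int[mu]_(x in `[(c - b)%R, (c - a)%R]) g x.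
Proof.
move=> mg g0.
have -> : `[a, b]%classic =
    reflect_line c @^-1` `[(c - b)%R, (c - a)%R]%classic.
  rewrite /reflect_line; apply/seteqP.
  by split => x /=; rewrite !in_itv/= => /andP[? ?]; apply/andP; split; lra.
rewrite -(ge0_integral_pushforward (measurable_reflect_line c) mu)//;
  last first.
  exact: measurable_funTS.
apply: eq_measure_integral => A mA _; exact: lebesgue_measure_reflect.
Qed.

End reflection.

Lemma measurable_fun_inv_ge0 {R : realType} d (T : measurableType d)
    (h : T -> R) : measurable_fun setT h -> (forall t, 0 <= h t) ->
  measurable_fun setT (fun t => (h t)^-1).
Proof.
move=> mh h0; rewrite (_ : (fun _ => _) = (@powR R ^~ (-1)) \o h).
  exact: (measurableT_comp (measurable_powR (-1)) mh).
by apply/funext => t /=; rewrite powR_inv1.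
Qed.

Section inverse_square_root.
Context {R : realType}.
Local Notation mu := (@lebesgue_measure R).

(** x ^ (- 1/2) on the positive half-line, and 0 elsewhere, as the square root
    of a negative number is 0 and so is the inverse of 0. *)
Definition rsqrt (x : R) : R := (Num.sqrt x)^-1.

Lemma rsqrt_ge0 x : 0 <= rsqrt x.
Proof. by rewrite invr_ge0 sqrtr_ge0. Qed.

Lemma rsqrt_le0 x : x <= 0 -> rsqrt x = 0.
Proof. by move=> x0; rewrite /rsqrt ler0_sqrtr// invr0. Qed.

Lemma rsqrt_ltr x y : 0 < x -> x < y -> rsqrt y <= rsqrt x.
Proof.
move=> x0 xy; rewrite lef_pV2 ?posrE ?sqrtr_gt0//; last exact: lt_trans xy.
by rewrite ler_sqrt ltW// (lt_trans x0).
Qed.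

Lemma sqr_rsqrt x : 0 <= x -> rsqrt x ^+ 2 = x^-1.
Proof. by move=> x0; rewrite exprVn sqr_sqrtr. Qed.

Lemma measurable_rsqrt : measurable_fun setT rsqrt.
Proof.
apply: measurable_fun_inv_ge0 => [|x]; last exact: sqrtr_ge0.
exact: (continuous_measurable_fun (@sqrt_continuous R)).
Qed.

Lemma integral_rsqrt_itv (a b : R) : 0 < a -> a < b ->
  (\int[mu]_(x in `[a, b]) (rsqrt x)%:E =
   (2 * Num.sqrt b - 2 * Num.sqrt a)%:E)%E.
Proof.
move=> a0 ab.
have cs x : {for x, continuous (fun x => 2 * Num.sqrt x : R)}.
  by apply: continuousM; [exact: cst_continuous|exact: sqrt_continuous].
have dF (x : R) : 0 < x ->
    is_derive x (1 : R) (fun x => 2 * Num.sqrt x : R) (rsqrt x).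
  move=> x0; have ds := is_derive1_sqrt x0.
  apply: is_derive_eq; rewrite /rsqrt.
  rewrite (invfM 2 (Num.sqrt x)).
  by apply: mulVKf; rewrite pnatr_eq0.
rewrite (@continuous_FTC2 _ rsqrt (fun x => 2 * Num.sqrt x) a b)//.
- apply: continuous_in_subspaceT => x; rewrite inE/= in_itv/= => /andP[ax _].
  apply: (@continuousV _ _ Num.sqrt x); last exact: sqrt_continuous.
  by rewrite gt_eqF// sqrtr_gt0 (lt_le_trans a0).
- split.
  + move=> x; rewrite in_itv/= => /andP[ax _].
    have x0 : 0 < x by exact: lt_trans ax.
    by have [] := dF _ x0.
  + by apply: cvg_at_right_filter; exact: cs.
  + by apply: cvg_at_left_filter; exact: cs.
- move=> x; rewrite in_itv/= => /andP[ax _].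
  have x0 : 0 < x by exact: lt_trans ax.
  by rewrite derive1E; have [_] := dF _ x0.
Qed.

Lemma integral_rsqrt_lty (b : R) : 0 < b ->
  (\int[mu]_(x in `[0%R, b]) (rsqrt x)%:E < +oo)%E.
Proof.
move=> b0.
have mq : measurable_fun setT (EFin \o rsqrt).
  by apply/measurable_EFinP; exact: measurable_rsqrt.
rewrite -integral_itv_obnd_cbnd//; last exact: measurable_funTS.
rewrite itv_open_bnd_bigcup.
have cF := @ge0_nondecreasing_set_cvg_integral _ (measurableTypeR R) _
  (fun n => `[(0 + n.+1%:R^-1)%R, b]%classic) (EFin \o rsqrt) mu.
apply: (@le_lt_trans _ _ (2 * Num.sqrt b)%:E); last by rewrite ltry.
apply: (cvge_to_le (cF _ _ _ _)) => //.
- apply/nondecreasing_seqP => n; rewrite subsetEset => x /=.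
  rewrite !in_itv/= !add0r => /andP[+ ->]; rewrite andbT; apply: le_trans.
  by rewrite lef_pV2 ?posrE// ler_nat.
- by move=> n; exact: measurable_funTS.
- by move=> n x _; rewrite lee_fin rsqrt_ge0.
- near=> n; rewrite add0r.
  have [nb|bn] := ltP n.+1%:R^-1 b.
    by rewrite integral_rsqrt_itv// lee_fin gerBl// mulr_ge0 ?sqrtr_ge0.
  (* here the segment from 1 / (n + 1) to b has at most one point *)
  rewrite (@integral_Sset1 _ _ _ b) ?lee_fin ?mulr_ge0 ?sqrtr_ge0//.
  move=> x /=; rewrite in_itv/= => /andP[nx xb]; apply/eqP.
  by rewrite eq_le xb (le_trans bn).
Unshelve. all: by end_near. Qed.

End inverse_square_root.

(** * The Fejer kernel *)

Section square_of_geometric_sum.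
Context {A : comPzRingType}.
Implicit Types (z : A) (n : nat).

(* [sqr_geometric_sum] is proved by induction on n; [tail] is the part of the
   square beyond degree n, divided by z ^ n.+1. *)
Let geom z n := \sum_(j < n.+1) z ^+ j.
Let tail z n := \sum_(i < n) (n - i)%:R * z ^+ i.

Let geomS z n : geom z n.+1 = geom z n + z ^+ n.+1.
Proof. by rewrite /geom big_ord_recr. Qed.

Let tailS z n : tail z n.+1 = tail z n + geom z n.
Proof.
rewrite /tail /geom [X in X + _](_ : _ = \sum_(i < n.+1) (n - i)%:R * z ^+ i).
  rewrite -big_split/=; apply: eq_bigr => i _.
  by rewrite subSn ?leq_ord// -natr1 mulrDl mul1r.
by rewrite big_ord_recr/= subnn mul0r addr0.
Qed.

Let mul_geom z n : z * geom z n = geom z n + z ^+ n.+1 - 1.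
Proof.
have : (z - 1) * geom z n = z ^+ n.+1 - 1 by rewrite -subrX1.
by rewrite mulrBl mul1r -addrA => <-; rewrite addrC subrK.
Qed.

Let mul_tail z n : z * tail z n = tail z n + geom z n - n.+1%:R.
Proof.
elim: n => [|n ih].
  by rewrite /tail /geom big_ord0 big_ord1 mulr0 expr0 add0r subrr.
rewrite tailS mulrDr ih mul_geom geomS -(natr1 n.+1).
move: (geom z n) (tail z n) (z ^+ n.+1) (n.+1%:R) => G T X m; ring.
Qed.

Lemma sqr_geometric_sum z n : (\sum_(j < n.+1) z ^+ j) ^+ 2 =
  \sum_(j < n.+1) j.+1%:R * z ^+ j +
  z ^+ n.+1 * \sum_(i < n) (n - i)%:R * z ^+ i.
Proof.
rewrite -/(geom z n) -/(tail z n); elim: n => [|n ih].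
  by rewrite /geom /tail big_ord0 !big_ord1 mulr0 addr0 expr1n mulr1.
rewrite geomS sqrrD ih [in RHS]big_ord_recr/= tailS (exprS z n.+1).
rewrite (mulrC z) -!mulrA !mulrDr mul_tail mul_geom -(natr1 n.+1).
move: (geom z n) (tail z n) (z ^+ n.+1) (n.+1%:R) => G T X m.
move: (\sum_(j < _) _) => B; ring.
Qed.

End square_of_geometric_sum.

Section fejer_kernel.
Context {R : realType}.

(** The Fejer kernel as a function of the angle. *)
Definition fejerR (n : nat) (x : R) : R :=
  ((\sum_(j < n.+1) cos (j%:R * x)) ^+ 2 +
   (\sum_(j < n.+1) sin (j%:R * x)) ^+ 2) / n.+1%:R.

Lemma expi_exprn (x : R) (j : nat) :
  (expi x : R[i]) ^+ j = Complex (cos (j%:R * x)) (sin (j%:R * x)).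
Proof.
elim: j => [|j ih]; first by rewrite expr0 mul0r cos0 sin0.
rewrite exprS ih -natr1 mulrDl mul1r addrC/= cosD sinD.
by congr Complex; ring.
Qed.

(** F_n is the square of the modulus of 1 + z + ... + z ^ n, divided by
    n + 1. *)
Lemma fejer_sqr_norm n (z : circle R) :
  fejer n z = `|\sum_(j < n.+1) (z : R[i]) ^+ j| ^+ 2 / n.+1%:R.
Proof.
have nz : `|z : R[i]| = 1 by apply/eqP; exact: circle_valP.
rewrite /fejer; move: (circle_val z) nz => {}z nz.
have z0 : z != 0 by rewrite -normr_eq0 nz oner_eq0.
have n0 : n.+1%:R != 0 :> R[i] by rewrite pnatr_eq0.
(* z ^- n S is the conjugate of S, as z^-1 is the conjugate of z *)
have -> : `|\sum_(j < n.+1) z ^+ j| ^+ 2 =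
    z ^- n * (\sum_(j < n.+1) z ^+ j) ^+ 2.
  rewrite sqr_normc expr2 mulrA mulrC; congr (_ * _).
  rewrite rmorph_sum/= (reindex_inj rev_ord_inj)/= mulr_sumr.
  apply: eq_bigr => j _; rewrite subSS rmorphXn/=.
  have zJ : (z^*)%C = z^-1 by rewrite invc_norm nz expr1n invr1 mul1r.
  rewrite zJ exprVn -[in z ^- n](subnK (leq_ord j)) exprD invfM.
  by rewrite mulrVK// unitfE expf_eq0 (negPf z0) andbF.
rewrite sqr_geometric_sum.
rewrite (_ : n.*2.+1 = n.+1 + n)%N; last by rewrite addSn addnn.
rewrite big_split_ord/= mulrDr mulrDl mulr_sumr mulr_suml.
congr (_ + _).
  apply: eq_bigr => j _; rewrite expfzDr// -exprnP -exprnN.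
  rewrite distnEr ?leq_ord//.
  have -> : 1 - (n - j)%:R / n.+1%:R = j.+1%:R / n.+1%:R :> R[i].
    rewrite natrB ?leq_ord// -{1}(divff n0) -mulrBl -!natr1.
    by congr (_ / _); ring.
  by move: (z ^+ j) (z ^- n) j.+1%:R n.+1%:R^-1 => a b c d; ring.
rewrite mulrA mulr_sumr mulr_suml; apply: eq_bigr => j _.
rewrite expfzDr// -exprnP -exprnN.
have -> : `|(n.+1 + j)%N%:Z - n%:Z|%N = j.+1.
  by rewrite distnEl; rewrite addSn ?leqW ?leq_addr// subSn ?leq_addr// addKn.
have -> : 1 - j.+1%:R / n.+1%:R = (n - j)%:R / n.+1%:R :> R[i].
  rewrite (natrB _ (ltnW (ltn_ord j))) -{1}(divff n0) -mulrBl -!natr1.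
  by congr (_ / _); ring.
rewrite exprD.
by move: (z ^+ j) (z ^- n) (z ^+ n.+1) (n - j)%:R n.+1%:R^-1 => a b c d e; ring.
Qed.

Lemma fejer_expi n x : fejer n (expi x) = (fejerR n x)%:C%C.
Proof.
rewrite fejer_sqr_norm -add_Re2_Im2 /fejerR.
under eq_bigr do rewrite expi_exprn.
have -> : \sum_(j < n.+1) Complex (cos (j%:R * x)) (sin (j%:R * x)) =
    Complex (\sum_(j < n.+1) cos (j%:R * x)) (\sum_(j < n.+1) sin (j%:R * x)).
  by elim/big_rec3: _ => // j a b c _ ->.
by rewrite rmorphM fmorphV rmorph_nat.
Qed.

Lemma fejerR_ge0 n x : 0 <= fejerR n x.
Proof. by rewrite divr_ge0// addr_ge0// sqr_ge0. Qed.

Lemma fejerR_le n x : fejerR n x <= 2 * n.+1%:R.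
Proof.
rewrite ler_pdivrMr// -mulrA -expr2 mulr_natl mulr2n lerD//;
  rewrite -ler_sqrt ?sqr_ge0// !sqrtr_sqr normr_nat;
  rewrite (le_trans (ler_norm_sum _ _ _))//;
  rewrite -[leRHS]mulr1 mulr_natl -[n.+1 in leRHS]card_ord -sumr_const;
  apply: ler_sum => i _; [exact: cos_max|exact: sin_max].
Qed.

Lemma cos_ge_half (x : R) : `|x| <= pi / 4 -> 2^-1 <= cos x.
Proof.
move=> xpi; have pi0 := pi_gt0 R.
have c0 y : `|y| <= pi / 2 -> 0 <= cos y.
  by move=> /ler_normlP[? ?]; apply: cos_ge0_pihalf; apply/andP; split; lra.
have cx0 : 0 <= cos x by apply: c0; lra.
have : 0 <= cos (x + x) by apply: c0; rewrite (le_trans (ler_normD _ _))//; lra.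
rewrite cosD -!expr2 => c2; have := cos2Dsin2 x => cs.
rewrite -(@ler_pXn2r _ 2)// ?nnegrE//; nra.
Qed.

(** For (n + 1) |x| <= pi / 4 every term of 1 + z + ... + z ^ n, with
    z = e ^ (i x), has real part at least 1/2. *)
Lemma fejerR_ge n x : n.+1%:R * `|x| <= pi / 4 -> n.+1%:R / 4 <= fejerR n x.
Proof.
move=> nx.
have cx (j : 'I_n.+1) : 2^-1 <= cos (j%:R * x).
  apply: cos_ge_half; rewrite normrM normr_nat (le_trans _ nx)//.
  by rewrite ler_wpM2r// ler_nat ltnW.
have sx : n.+1%:R / 2 <= \sum_(j < n.+1) cos (j%:R * x).
  rewrite mulr_natl -[n.+1 in leLHS]card_ord -sumr_const.
  by apply: ler_sum => j _.
rewrite ler_pdivlMr//.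
apply: (@le_trans _ _ ((\sum_(j < n.+1) cos (j%:R * x)) ^+ 2)); last first.
  by rewrite lerDl sqr_ge0.
have -> : n.+1%:R / 4 * n.+1%:R = (n.+1%:R / 2) ^+ 2 :> R by field.
by rewrite ler_pXn2r// nnegrE ?divr_ge0// (le_trans _ sx)// divr_ge0.
Qed.

Lemma measurable_fejerR n : measurable_fun setT (fejerR n).
Proof.
have mj (j : nat) : measurable_fun setT (fun x : R => j%:R * x).
  exact: measurable_funM.
apply: measurable_funM => //; apply: measurable_funD;
  apply: measurable_funX; apply: measurable_sum => j;
  apply: measurableT_comp => //; apply: continuous_measurable_fun;
  [exact: continuous_cos|exact: continuous_sin].
Qed.

End fejer_kernel.

(** * Weighted L^1 spaces on the circle *)

Section weighted_L1_space.
Context {R : realType}.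
Local Notation T := (circle R).
Local Notation m := (circle_measure R).
Variable w : T -> R.
Hypothesis mw : measurable_fun setT w.

Lemma weight_mulE (f : T -> R[i]) t :
  weight_mul w f t =
  Complex (@complex.Re R (f t) * w t) (@complex.Im R (f t) * w t).
Proof.
by rewrite /weight_mul; case: (f t) => a b /=; congr Complex; ring.
Qed.

Lemma L0_weight_mul (f : T -> R[i]) : L0 f -> L0 (weight_mul w f).
Proof.
move=> [mRe mIm]; split.
  rewrite (_ : _ \o _ = (@complex.Re R \o f) \* w); last first.
    by apply/funext => t; rewrite /= weight_mulE.
  exact: measurable_funM.
rewrite (_ : _ \o _ = (@complex.Im R \o f) \* w); last first.
  by apply/funext => t; rewrite /= weight_mulE.
exact: measurable_funM.
Qed.

Local Open Scope ereal_scope.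

Lemma measurable_cmod (f : T -> R[i]) : L0 f -> measurable_fun setT (cmod f).
Proof.
move=> [mRe mIm]; apply/measurable_EFinP.
rewrite (_ : (fun _ => _) = @Num.sqrt R \o
    (fun t => (@complex.Re R \o f) t ^+ 2 + (@complex.Im R \o f) t ^+ 2)%R).
  apply: measurableT_comp.
    exact: (continuous_measurable_fun (@sqrt_continuous R)).
  by apply: measurable_funD; exact: measurable_funX.
by apply/funext => t /=; case: (f t).
Qed.

Lemma cmod_ge0 (f : T -> R[i]) t : 0 <= cmod f t.
Proof. by rewrite lee_fin /cmod; case: (f t) => a b; rewrite sqrtr_ge0. Qed.

Hypothesis w_ge1 : forall t, (1 <= w t)%R.

Let w_ge0 t : (0 <= w t)%R. Proof. exact: le_trans (w_ge1 t). Qed.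

Lemma cmod_weight_mul (f : T -> R[i]) t :
  cmod (weight_mul w f) t = cmod f t * (w t)%:E.
Proof.
rewrite /cmod /weight_mul ComplexField.Normc.normcM EFinM; congr (_ * _%:E).
by rewrite /= expr0n/= addr0 sqrtr_sqr ger0_norm.
Qed.

Hypothesis iw : m.-integrable setT (EFin \o w).

(** The function norm of L^1(w). *)
Let rho (g : T -> \bar R) := \int[m]_t (g t * (w t)%:E).

Let mM (g : T -> \bar R) : L0_plus g ->
  measurable_fun setT (fun t => g t * (w t)%:E).
Proof.
by move=> [mg _]; apply: emeasurable_funM => //; apply/measurable_EFinP.
Qed.

Let M0 (g : T -> \bar R) t : L0_plus g -> 0 <= g t * (w t)%:E.
Proof. by move=> [_ g0]; rewrite mule_ge0// lee_fin. Qed.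

Lemma banach_function_norm_weighted : banach_function_norm rho.
Proof.
split.
- by move=> f Lf; apply: integral_ge0 => t _; exact: M0.
- move=> f Lf.
  have -> : rho f = \int[m]_t `|f t * (w t)%:E|.
    by apply: eq_integral => t _; rewrite gee0_abs// M0.
  rewrite ae_eq_integral_abs//; last exact: mM.
  split; apply: filterS => t /=.
    move=> /(_ I) /eqP; rewrite mule_eq0 => /orP[/eqP//|/eqP[wt]].
    by have := w_ge1 t; rewrite wt ler10.
  by move=> -> _; rewrite mul0e.
- move=> f a Lf a0; rewrite /rho -ge0_integralZl//.
  + by apply: eq_integral => t _; rewrite muleA.
  + exact: mM.
  + by move=> t _; exact: M0.
- move=> f g Lf Lg; rewrite /rho -ge0_integralD//.
  + rewrite le_eqVlt; apply/orP; left; apply/eqP; apply: eq_integral => t _.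
    by rewrite ge0_muleDl//; [case: Lf|case: Lg].
  + by move=> t _; exact: M0.
  + exact: mM.
  + by move=> t _; exact: M0.
  + exact: mM.
- move=> f g Lf Lg gf; apply: ae_ge0_le_integral => //.
  + by move=> t _; exact: M0.
  + exact: mM.
  + by move=> t _; exact: M0.
  + exact: mM.
  + apply: filterS gf => t gft _; apply: lee_wpmul2r => //.
    by rewrite lee_fin.
- (* the convergence holds outside a null set N, which the integrals ignore *)
  move=> fn f Lfn Lf [N [mN N0 fN]].
  have nfN t : (~` N) t -> nondecreasing_seq (fn ^~ t) /\ fn ^~ t @ \oo --> f t.
    by move=> Nt; apply: contrapT => /fN.
  have mNC : measurable (~` N) by exact: measurableC.
  have rhoE g : L0_plus g -> rho g = \int[m]_(t in ~` N) (g t * (w t)%:E).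
    move=> Lg; rewrite /rho (ge0_negligible_integral _ _ _ _ N0)//.
    + by rewrite setTD.
    + exact: mM.
    + by move=> t _; exact: M0.
  have rhoE' : rho \o fn = fun n => \int[m]_(t in ~` N) (fn n t * (w t)%:E).
    by apply/funext => n; exact: rhoE.
  have nd t : (~` N) t -> nondecreasing_seq (fun n => fn n t * (w t)%:E).
    move=> Nt a b ab; apply: lee_wpmul2r; first by rewrite lee_fin.
    by have [+ _] := nfN _ Nt; apply.
  split.
    rewrite rhoE' => a b ab; apply: ge0_le_integral => //.
    + by move=> t _; exact: M0.
    + by apply: measurable_funTS; exact: mM.
    + by apply: measurable_funTS; exact: mM.
    + by move=> t Nt; exact: nd.
  rewrite rhoE' rhoE//.
  have -> : \int[m]_(t in ~` N) (f t * (w t)%:E) =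
      \int[m]_(t in ~` N) limn (fun n => fn n t * (w t)%:E).
    apply: eq_integral => t; rewrite inE => Nt; apply/esym/cvg_lim => //.
    by apply: cvgeZr => //; have [] := nfN _ Nt.
  apply: cvg_monotone_convergence => //.
  + by move=> n; apply: measurable_funTS; exact: mM.
  + by move=> n t _; exact: M0.
- move=> E mE _; have : \int[m]_t (EFin \o w) t < +oo.
    exact: integrable_lty iw.
  apply: le_lt_trans; apply: ge0_le_integral => //.
  + by move=> t _; rewrite mule_ge0// lee_fin.
  + apply: emeasurable_funM; exact/measurable_EFinP.
  + exact/measurable_EFinP.
  + by move=> t _ /=; rewrite -EFinM lee_fin ler_piMl// indicE.
- move=> E mE; exists 1%R; split => // f Lf; rewrite mul1e.
  have [mf f0] := Lf.
  apply: (@le_trans _ _ (\int[m]_t f t)).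
    by apply: ge0_subset_integral.
  apply: ge0_le_integral => //; first exact: mM.
  by move=> t _; apply: lee_pemulr => //; rewrite lee_fin.
Qed.

Lemma banach_function_space_weighted_L1 :
  banach_function_space (weighted_L1 w) (weighted_L1_norm w).
Proof.
have nE (f : T -> R[i]) : weighted_L1_norm w f = rho (cmod f).
  by apply: eq_integral => t _; exact: cmod_weight_mul.
exists rho; split => //; first exact: banach_function_norm_weighted.
apply/seteqP; split => f /=.
  by move=> [Lf [_]]; rewrite -[L1_norm _]/(weighted_L1_norm w f) nE.
move=> [Lf rf]; split => //; split; first exact: L0_weight_mul.
by rewrite -[L1_norm _]/(weighted_L1_norm w f) nE.
Qed.

End weighted_L1_space.

(** * Separability *)

Section step_functions.
Context {R : realType}.
Local Notation mu := (@lebesgue_measure R).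

(** The step function with rational values p.2 on consecutive intervals of
    length 1 / (p.1 + 1) starting at a, and 0 outside of them. *)
Definition rat_step (a : R) (p : nat * seq rat) (x : R) : R :=
  \sum_(i < size p.2) ratr p.2`_i *
    \1_(`[a + i%:R / p.1.+1%:R, a + i.+1%:R / p.1.+1%:R[%classic) x.

Lemma measurable_rat_step a p : measurable_fun setT (rat_step a p).
Proof. by apply: measurable_sum => i; exact: measurable_funM. Qed.

Lemma rat_stepE a p x : a <= x ->
  rat_step a p x = ratr p.2`_(Num.truncn ((x - a) * p.1.+1%:R)).
Proof.
move=> ax; set N := p.1.+1; set k := Num.truncn _.
have N0 : 0 < N%:R :> R by [].
have /truncn_itv : 0 <= (x - a) * N%:R by rewrite mulr_ge0// subr_ge0.
rewrite -/k => kx.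
have E (i : nat) :
    \1_(`[a + i%:R / N%:R, a + i.+1%:R / N%:R[%classic) x = (i == k)%:R :> R.
  rewrite indicE mem_setE in_itv/= -!lerBrDl -!ltrBlDl.
  congr ((nat_of_bool _)%:R).
  rewrite ler_pdivrMr// ltr_pdivlMr//.
  apply/idP/eqP => [ix|->//]; apply/eqP; rewrite eqn_leq.
  move: kx ix => /andP[k1 k2] /andP[i1 i2].
  have := le_lt_trans i1 k2; rewrite ltr_nat ltnS => ->/=.
  by have := le_lt_trans k1 i2; rewrite ltr_nat ltnS.
rewrite /rat_step; under eq_bigr do rewrite E.
have [kp|pk] := ltnP k (size p.2).
  rewrite (bigD1 (Ordinal kp))//= eqxx mulr1 big1 ?addr0// => i ik.
  by rewrite (negPf (_ : (i : nat) != k)) ?mulr0.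
rewrite nth_default// rmorph0 big1// => i _.
by rewrite ltn_eqF ?mulr0// (leq_trans (ltn_ord i)).
Qed.

Lemma rat_step_bounded a p : exists M, forall x, `|rat_step a p x| <= M.
Proof.
exists (\sum_(i < size p.2) `|ratr p.2`_i|) => x.
rewrite (le_trans (ler_norm_sum _ _ _))//; apply: ler_sum => i _.
by rewrite normrM ler_piMr// ger0_norm// indicE.
Qed.

(** Heine's theorem on a segment; only one of the two points need lie in it. *)
Lemma segment_unif_continuous (a b : R) (g : R -> R) (e : R) :
  continuous g -> 0 < e ->
  exists2 d, 0 < d &
    forall x y, x \in `[a, b] -> `|x - y| < d -> `|g x - g y| < e.
Proof.
move=> cg e0.
have := @segment_compact R a b; rewrite compact_near_coveringP.
move=> /(_ _ (0^'+) (fun d x => forall y, `|x - y| < d -> `|g x - g y| < e)).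
case.
  move=> x _; have /cvgrPdist_lt /(_ (e / 2)) := cg x.
  rewrite divr_gt0// => /(_ isT) /nbhs_ballP[d /= d0 dg].
  exists (ball x (d / 2), [set r | r < d / 2]) => /=.
    split; first by apply: nbhsx_ballx; rewrite divr_gt0.
    by apply: nbhs_right_lt; rewrite divr_gt0.
  move=> [y r] [/= xy rd] z yz.
  have gy : `|g x - g y| < e / 2.
    by apply: dg; rewrite /ball/= (lt_trans xy)// ltr_pdivrMr// ltr_pMr// ltr1n.
  have gz : `|g x - g z| < e / 2.
    apply: dg; rewrite /ball/= -(subrK y x) -addrA (splitr d).
    by rewrite (le_lt_trans (ler_normD _ _))// ltrD// (lt_trans yz).
  rewrite -(subrK (g x) (g y)) -addrA (splitr e).
  by rewrite (le_lt_trans (ler_normD _ _))// ltrD// distrC.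
move=> d /= d0 H; exists (d / 2); first by rewrite divr_gt0.
move=> x y xab; apply: (H (d / 2)) => //=.
  by rewrite sub0r normrN gtr0_norm ?divr_gt0// ltr_pdivrMr// ltr_pMr// ltr1n.
by rewrite divr_gt0.
Qed.

Lemma rat_step_approx_continuous (a b : R) (g : R -> R) (e : R) :
  continuous g -> 0 < e ->
  exists p, forall x, x \in `[a, b] -> `|g x - rat_step a p x| <= e.
Proof.
move=> cg e0.
have [d d0 H] :=
  @segment_unif_continuous a b g (e / 2) cg (divr_gt0 e0 (ltr0n _ 2)).
(* M intervals of length 1 / N < d cover the segment *)
pose n := Num.truncn d^-1; pose N := n.+1.
pose M := (Num.truncn ((b - a) * N%:R)).+1.
have Nd : N%:R^-1 < d by rewrite invf_plt ?posrE// truncnS_gt.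
pose c (i : nat) := a + i%:R / N%:R.
have /choice[q qc] (i : nat) : exists q : rat, `|g (c i) - ratr q| < e / 2.
  have [q] : exists q : rat, ratr q \in `](g (c i) - e / 2), (g (c i) + e / 2)[.
    by apply: rat_in_itvoo; lra.
  rewrite in_itv/= => /andP[? ?]; exists q.
  by rewrite ltr_norml; apply/andP; split; lra.
exists (n, mkseq q M) => x xab.
have /andP[ax xb] : a <= x <= b by move: xab; rewrite in_itv.
rewrite rat_stepE//=; set k := Num.truncn _.
have kM : (k < M)%N.
  by rewrite ltnS; apply: le_truncn; rewrite ler_pM2r// lerD2r.
rewrite nth_mkseq// -(subrK (g (c k)) (g x)) -addrA (splitr e) ltW//.
rewrite (le_lt_trans (ler_normD _ _))// ltrD//; apply: H => //.
have /truncn_itv : 0 <= (x - a) * N%:R by rewrite mulr_ge0// subr_ge0.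
rewrite -/k => /andP[k1 k2]; apply: le_lt_trans Nd.
rewrite /c opprD addrA ger0_norm.
  rewrite lerBlDr -[X in _ <= X + _]mul1r -mulrDl ler_pdivlMr//.
  by rewrite (addrC 1) natr1 ltW.
by rewrite subr_ge0 ler_pdivrMr.
Qed.

Local Open Scope ereal_scope.

(** Step functions with rational data are dense in L^1 of a segment. *)
Lemma rat_step_approx_integrable (a b : R) (u : R -> R) (e : R) : (a < b)%R ->
  mu.-integrable `[a, b] (EFin \o u) -> (0 < e)%R ->
  exists p, \int[mu]_(x in `[a, b]) `|(u x - rat_step a p x)%:E| < e%:E.
Proof.
move=> ab iu e0.
have muab : mu `[a, b] = (b - a)%:E.
  by rewrite lebesgue_measure_itv/= lte_fin ab EFinB.
have [||g_ [cg ig ug]] :=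
  @approximation_continuous_integrable R `[a, b] u _ _ iu.
- exact: measurable_itv.
- by rewrite [X in X < _]muab ltry.
have [n gn] : exists n,
    \int[mu]_(x in `[a, b]) `|(u x - g_ n x)%:E| < (e / 2)%:E.
  have /fine_cvgP[fg /cvgrPdist_lt/(_ (e / 2)%R)] := ug.
  rewrite divr_gt0// => /(_ isT) fg'.
  have [n [fn +]] := filter_ex (filterI fg fg').
  rewrite sub0r normrN => gn; exists n; rewrite -(fineK fn) lte_fin.
  exact: le_lt_trans (ler_norm _) gn.
pose d := (e / 4 / (b - a))%R.
have ba0 : (0 < b - a)%R by rewrite subr_gt0.
have d0 : (0 < d)%R by rewrite !divr_gt0.
have [p gp] := @rat_step_approx_continuous a b _ _ (cg n) d0.
have mu_ : measurable_fun `[a, b] u.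
  by apply/measurable_EFinP; exact: measurable_int iu.
have mg_ : measurable_fun `[a, b] (g_ n).
  by apply/measurable_EFinP; exact: measurable_int (ig n).
have ms_ : measurable_fun `[a, b] (rat_step a p).
  by apply: measurable_funTS; exact: measurable_rat_step.
have mB (h k : R -> R) : measurable_fun `[a, b] h -> measurable_fun `[a, b] k ->
    measurable_fun `[a, b] (fun x => `|(h x - k x)%:E|).
  move=> mh mk; apply: measurableT_comp => //; apply/measurable_EFinP.
  exact: measurable_funB.
exists p.
apply: (@le_lt_trans _ _ (\int[mu]_(x in `[a, b]) `|(u x - g_ n x)%:E| +
   \int[mu]_(x in `[a, b]) `|(g_ n x - rat_step a p x)%:E|)).
  rewrite -ge0_integralD//; [|exact: mB..].
  apply: ge0_le_integral => //.
  - exact: mB.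
  - by apply: emeasurable_funD; exact: mB.
  - by move=> x _; rewrite -EFinD lee_fin; exact: ler_distD.
rewrite [ltRHS](_ : _ = (e / 2)%:E + (e / 2)%:E); last first.
  by rewrite -EFinD -splitr.
apply: lteD => //.
apply: (@le_lt_trans _ _ (d%:E * mu `[a, b])); last first.
  rewrite muab -EFinM lte_fin /d divfK ?gt_eqF//; lra.
apply: integral_le_bound => //.
- by apply/measurable_EFinP; exact: measurable_funB.
- by rewrite lee_fin ltW.
- by apply/aeW => x; rewrite /= => xab; rewrite lee_fin gp.
Qed.

End step_functions.

Section separability.
Context {R : realType}.
Local Notation T := (circle R).
Local Notation m := (circle_measure R).
Local Notation mu := (@lebesgue_measure R).
Local Open Scope ereal_scope.

Lemma integral_itvNpipi (g : R -> \bar R) : measurable_fun setT g ->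
  \int[mu]_(x in `[(- pi)%R, pi]) g x = \int[mu]_(x in `](- pi)%R, pi]) g x.
Proof.
by move=> mg; rewrite integral_itv_obnd_cbnd//; exact: measurable_funTS.
Qed.

(** Rational step functions of the argument are dense in L^1 of the circle, for
    real-valued functions. *)
Lemma rat_step_arg_approx (u : T -> R) (e : R) :
  m.-integrable setT (EFin \o u) -> (0 < e)%R ->
  exists p, \int[m]_z `|(u z - rat_step (- pi) p (arg z))%:E| < e%:E.
Proof.
move=> /integrableP[mu_ ioo] e0; have pi0 := pi_gt0 R.
have mue : measurable_fun setT (fun x : R => (u (expi x))%:E).
  exact: (measurableT_comp mu_ measurable_expi).
have mur : measurable_fun setT (fun x : R => u (expi x)).
  exact/measurable_EFinP.
have c0 : (0 < (2 * pi)^-1 :> R)%R by rewrite invr_gt0 mulr_gt0.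
have iu : mu.-integrable `[(- pi)%R, pi] (EFin \o (u \o expi)).
  apply/integrableP; split; first exact: measurable_funTS.
  move: ioo; rewrite ge0_integral_circle//; last first.
    by apply: measurableT_comp.
  rewrite ltey => h; rewrite ltey; apply: contra h => /eqP ->.
  by rewrite gt0_muley// lte_fin.
have [p hp] := rat_step_approx_integrable _ _ _ _ (ltNpipi R) iu e0.
exists p; have ms := measurable_rat_step (- pi : R)%R p.
have md :
    measurable_fun setT (fun z => `|(u z - rat_step (- pi) p (arg z))%:E|).
  apply: measurableT_comp => //; apply/measurable_EFinP; apply: measurable_funB.
    exact/measurable_EFinP.
  exact: (measurableT_comp ms measurable_arg).
rewrite ge0_integral_circle// integral_itvNpipi; last first.
  exact: (measurableT_comp md measurable_expi).
rewrite (_ : \int[mu]_(x in _) _ =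
    \int[mu]_(x in `](- pi)%R, pi]) `|(u (expi x) - rat_step (- pi) p x)%:E|).
  rewrite -integral_itvNpipi; last first.
    apply: measurableT_comp => //; apply/measurable_EFinP.
    exact: measurable_funB.
  apply: le_lt_trans hp; rewrite -[leRHS]mul1e; apply: lee_wpmul2r.
    exact: integral_ge0.
  rewrite lee_fin invf_le1 ?mulr_gt0//.
  by have := pi_ge2 R; lra.
by apply: eq_integral => x; rewrite inE/= in_itv/= => /arg_expi ->.
Qed.

Lemma separable_weighted_L1 (w : T -> R) : measurable_fun setT w ->
  (forall t, (0 < w t)%R) -> separable (weighted_L1 w) (weighted_L1_norm w).
Proof.
move=> mw w0.
(* multiplication by w is an isometry from L^1(w) onto L^1, so a dense family
   of L^1 is divided by w *)
pose s (p : nat * seq rat) (z : T) := rat_step (- pi)%R p (arg z).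
pose F (p : (nat * seq rat) * (nat * seq rat)) (z : T) : R[i] :=
  Complex (s p.1 z / w z)%R (s p.2 z / w z)%R.
have ms p : measurable_fun setT (s p).
  exact: (measurableT_comp (measurable_rat_step _ p) measurable_arg).
have sb p : exists M, forall z, (`|s p z| <= M)%R.
  by have [M sM] := rat_step_bounded (- pi : R)%R p; exists M => z; exact: sM.
have wF p z : weight_mul w (F p) z = Complex (s p.1 z) (s p.2 z).
  by rewrite weight_mulE/= !divfK// gt_eqF.
have cle (a b : R) : (ComplexField.Normc.normc (Complex a b) <= `|a| + `|b|)%R.
  rewrite -(@ler_pXn2r _ 2)// ?nnegrE ?sqrtr_ge0 ?addr_ge0//=.
  rewrite sqr_sqrtr ?addr_ge0 ?sqr_ge0// sqrrD !real_normK ?num_real//.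
  by rewrite -addrA lerD2l lerDr mulrn_wge0 ?mulr_ge0.
have mabs (h : T -> R) : measurable_fun setT h ->
    measurable_fun setT (fun z => `|(h z)%:E|).
  by move=> mh; apply: measurableT_comp => //; exact/measurable_EFinP.
have L1le (h : T -> R[i]) : L0 h ->
    L1_norm h <= \int[m]_z `|(@complex.Re R (h z))%:E| +
                 \int[m]_z `|(@complex.Im R (h z))%:E|.
  move=> Lh; have [mRe mIm] := Lh.
  rewrite -ge0_integralD//; [|exact: mabs..].
  apply: ge0_le_integral => //.
  - by move=> z _; exact: cmod_ge0.
  - exact: measurable_cmod.
  - by apply: emeasurable_funD; exact: mabs.
  - by move=> z _; rewrite /cmod -EFinD lee_fin; case: (h z).
exists (range F); split.
- exact: (sub_countable (card_image_le _ _) (countableP _)).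
- move=> _ [p _ <-].
  have LF : L0 (F p).
    by split; apply: measurable_funM => //;
      apply: measurable_fun_inv_ge0 => // t; exact: ltW.
  have LwF : L0 (weight_mul w (F p)) by exact: L0_weight_mul.
  split => //; split => //; apply: (le_lt_trans (L1le _ LwF)).
  have bnd (h : T -> R) M :
      measurable_fun setT h -> (forall z, `|h z| <= M)%R ->
      \int[m]_z `|(h z)%:E| < +oo.
    move=> mh hM; apply: (@le_lt_trans _ _ (M%:E * m setT)).
      apply: integral_le_bound => //; first exact/measurable_EFinP.
        by rewrite lee_fin (le_trans _ (hM (expi 0)))//.
      by apply/aeW => z _; rewrite lee_fin.
    by rewrite probability_setT mule1 ltry.
  have [M1 sM1] := sb p.1; have [M2 sM2] := sb p.2.
  under eq_integral do rewrite wF/=.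
  under [X in _ + X]eq_integral do rewrite wF/=.
  by apply: lte_add_pinfty; [exact: (bnd _ M1)|exact: (bnd _ M2)].
- move=> f e [Lf [Lwf noo]] e0.
  have [mRe mIm] := Lwf.
  have dominated (h : T -> R) : measurable_fun setT h ->
      (forall z, `|h z|%:E <= cmod (weight_mul w f) z) ->
      m.-integrable setT (EFin \o h).
    move=> mh hle; apply/integrableP; split; first exact/measurable_EFinP.
    apply: le_lt_trans noo; apply: ge0_le_integral => //.
    - exact: mabs.
    - exact: measurable_cmod.
    - by move=> z _; exact: hle.
  have iRe : m.-integrable setT (EFin \o (@complex.Re R \o weight_mul w f)).
    apply: dominated => // z; rewrite lee_fin /cmod/=.
    case: (weight_mul w f z) => a b /=.
    by rewrite -sqrtr_sqr ler_wsqrtr// lerDl sqr_ge0.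
  have iIm : m.-integrable setT (EFin \o (@complex.Im R \o weight_mul w f)).
    apply: dominated => // z; rewrite lee_fin /cmod/=.
    case: (weight_mul w f z) => a b /=.
    by rewrite -sqrtr_sqr ler_wsqrtr// lerDr sqr_ge0.
  have e20 : (0 < e / 2)%R by rewrite divr_gt0.
  have [p1 hp1] := rat_step_arg_approx _ _ iRe e20.
  have [p2 hp2] := rat_step_arg_approx _ _ iIm e20.
  exists (F (p1, p2)); first by exists (p1, p2).
  have wE : weight_mul w (fun t => f t - F (p1, p2) t)%R = fun t =>
      Complex (@complex.Re R (weight_mul w f t) - s p1 t)%R
              (@complex.Im R (weight_mul w f t) - s p2 t)%R.
    apply/funext => t; rewrite !weight_mulE /F; case: (f t) => a b /=.
    by congr Complex; rewrite mulrBl divfK// gt_eqF.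
  rewrite /weighted_L1_norm wE.
  apply: (le_lt_trans (L1le _ _)).
    by split; exact: measurable_funB.
  by rewrite (splitr e) EFinD; apply: lteD.
Qed.

End separability.

(** * The counterexample *)

Section lower_bounds_for_integrals.
Local Open Scope ereal_scope.
Import HBNNSimple.

(** A Markov inequality that needs no measurability of g. *)
Lemma ge_integral_of_ge_on d (T : measurableType d) (R : realType)
    (mu : {measure set T -> \bar R}) (A : set T) (c : R) (g : T -> \bar R) :
  measurable A -> (0 <= c)%R -> (forall t, 0 <= g t) ->
  (forall t, A t -> c%:E <= g t) -> c%:E * mu A <= \int[mu]_t g t.
Proof.
move=> mA c0 g0 cg.
pose h := scale_nnsfun (indic_nnsfun R mA) c0.
have -> : c%:E * mu A = \int[mu]_t (h t)%:E.
  under eq_integral do rewrite /= EFinM.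
  rewrite ge0_integralZl//.
  - by rewrite integral_indic// setIT.
  - by apply/measurable_EFinP; exact/measurable_indicP.
  - by move=> t _; rewrite lee_fin.
rewrite integralT_nnsfun ge0_integralTE//; apply: ereal_sup_ubound.
exists h => // t; rewrite /= /mindic indicE; have [At|At] := boolP (t \in A).
  by rewrite mulr1 cg// -inE.
by rewrite mulr0.
Qed.

End lower_bounds_for_integrals.

Section counterexample.
Context {R : realType}.
Local Notation T := (circle R).
Local Notation m := (circle_measure R).
Local Notation mu := (@lebesgue_measure R).

Lemma integral_rsqrt_sym_lty (a : R) : 0 < a ->
  (\int[mu]_(x in `[(- a)%R, a]) (rsqrt x)%:E < +oo)%E.
Proof.
move=> a0; apply: le_lt_trans (integral_rsqrt_lty _ a0).
rewrite [leRHS](_ : _ =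
    \int[mu]_(x in `[(- a)%R, a] `&` `[0%R, a]) (rsqrt x)%:E)%E.
  rewrite integral_mkcondr le_eqVlt; apply/orP; left; apply/eqP.
  apply: eq_integral => x; rewrite inE/= in_itv/= => /andP[_ xa].
  rewrite patchE mem_setE in_itv/= xa andbT; case: leP => // x0.
  by rewrite rsqrt_le0// ltW.
congr (integral _ _ _); apply/seteqP; split => x /=; rewrite !in_itv/=.
  move=> /andP[x0 xa]; split; rewrite ?x0 xa ?andbT//.
  by rewrite (le_trans _ x0)// oppr_le0 ltW.
by case.
Qed.

(** The function with an inverse-square-root singularity on one side of the
    point 1, and the weight with the same singularity on the other side. *)
Definition one_sided_fun (z : T) : R[i] := (rsqrt (arg z))%:C%C.
Definition one_sided_weight (z : T) : R := 1 + rsqrt (- arg z).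

Local Notation f := one_sided_fun.
Local Notation w := one_sided_weight.

Lemma one_sided_weight_ge1 z : 1 <= w z.
Proof. by rewrite lerDl rsqrt_ge0. Qed.

Lemma measurable_one_sided_weight : measurable_fun setT w.
Proof.
apply: measurable_funD => //; apply: (measurableT_comp measurable_rsqrt).
by apply: measurable_funN; exact: measurable_arg.
Qed.

Lemma integral_rsqrt_arg_lty : (\int[m]_z (rsqrt (arg z))%:E < +oo)%E.
Proof.
rewrite (ge0_integral_circle_arg (fun x => (rsqrt x)%:E)).
- rewrite lte_mul_pinfty// ?lee_fin ?invr_ge0 ?mulr_ge0 ?pi_ge0//.
  by rewrite integral_rsqrt_sym_lty// pi_gt0.
- by apply/measurable_EFinP; exact: measurable_rsqrt.
- by move=> x; rewrite lee_fin rsqrt_ge0.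
Qed.

Lemma integral_rsqrt_Narg_lty : (\int[m]_z (rsqrt (- arg z))%:E < +oo)%E.
Proof.
have mq : measurable_fun setT (fun x : R => (rsqrt x)%:E).
  by apply/measurable_EFinP; exact: measurable_rsqrt.
rewrite (ge0_integral_circle_arg (fun x => (rsqrt (- x))%:E)).
- rewrite lte_mul_pinfty// ?lee_fin ?invr_ge0 ?mulr_ge0 ?pi_ge0//.
  under eq_integral do rewrite -sub0r.
  rewrite (ge0_integral_reflect 0 _ _ (fun x => (rsqrt x)%:E))//.
    by rewrite !sub0r opprK integral_rsqrt_sym_lty// pi_gt0.
  by move=> x; rewrite lee_fin rsqrt_ge0.
- by apply: (measurableT_comp mq); exact: measurable_funN.
- by move=> x; rewrite lee_fin rsqrt_ge0.
Qed.

Lemma integrable_one_sided_weight : m.-integrable setT (EFin \o w).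
Proof.
have -> : EFin \o w = (EFin \o cst 1%R) \+ (fun z => (rsqrt (- arg z))%:E).
  by apply/funext => z /=; rewrite -EFinD.
apply: integrableD => //; first exact: finite_measure_integrable_cst.
apply/integrableP; split.
  apply/measurable_EFinP; apply: (measurableT_comp measurable_rsqrt).
  by apply: measurable_funN; exact: measurable_arg.
under eq_integral do rewrite gee0_abs ?lee_fin ?rsqrt_ge0//.
exact: integral_rsqrt_Narg_lty.
Qed.

Lemma ess_sup_inv_one_sided_weight :
  ('N[m]_+oo [(fun z => ((w z)%:E)^-1)] < +oo)%E.
Proof.
rewrite unlock /Lnorm; case: ifP => _ //.
apply: (@le_lt_trans _ _ 1%E); last by rewrite ltry.
apply/ess_supP; apply/aeW => z /=.
have w0 : 0 < w z by rewrite (lt_le_trans _ (one_sided_weight_ge1 z)).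
rewrite inver gt_eqF// lee_fin gtr0_norm ?invr_gt0//.
by rewrite invf_le1// one_sided_weight_ge1.
Qed.

Lemma L0_one_sided_fun : L0 f.
Proof.
split.
  exact: (measurableT_comp measurable_rsqrt measurable_arg).
by rewrite (_ : _ \o _ = cst 0).
Qed.

Lemma weighted_L1_one_sided_fun : weighted_L1 w f.
Proof.
have mw := measurable_one_sided_weight.
split; first exact: L0_one_sided_fun.
split; first exact: (L0_weight_mul _ mw _ L0_one_sided_fun).
apply: le_lt_trans integral_rsqrt_arg_lty.
rewrite le_eqVlt; apply/orP; left; apply/eqP; apply: eq_integral => z _.
rewrite (cmod_weight_mul _ one_sided_weight_ge1) /cmod /f/= expr0n/= addr0.
rewrite sqrtr_sqr ger0_norm ?rsqrt_ge0// -EFinM; congr (_%:E).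
rewrite /w mulrDr mulr1; have [z0|z0] := leP (arg z) 0.
  by rewrite rsqrt_le0// mul0r addr0.
by rewrite [rsqrt (- _)]rsqrt_le0 ?mulr0 ?addr0// oppr_le0 ltW.
Qed.

(** The scale at which the n-th Fejer kernel is bounded below by a multiple of
    n + 1; the estimates take place at distance at most this one from the
    point 1. *)
Definition fejer_scale (n : nat) : R := pi / (8 * n.+1%:R).

Lemma fejer_scale_gt0 n : 0 < fejer_scale n.
Proof. by rewrite divr_gt0 ?pi_gt0// mulr_gt0. Qed.

Lemma fejer_scale_le n : fejer_scale n <= pi / 8.
Proof.
rewrite ler_wpM2l ?pi_ge0// lef_pV2 ?posrE ?mulr_gt0//.
by rewrite ler_peMr// ler1n.
Qed.

Lemma mul_fejer_scale n : n.+1%:R * fejer_scale n = pi / 8.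
Proof. by rewrite /fejer_scale; field; rewrite addrC natr1 pnatr_eq0. Qed.

Lemma expiD2pi (x : R) : expi (x + pi *+ 2) = expi x.
Proof. by apply: val_inj; rewrite /= cosD2pi sinD2pi. Qed.

Lemma measurable_rsqrt_arg_expi :
  measurable_fun setT (fun x : R => rsqrt (arg (expi x))).
Proof.
have mr := measurableT_comp (@measurable_rsqrt R) (@measurable_arg R).
exact: (measurableT_comp mr (@measurable_expi R)).
Qed.

(** To the left of - pi, and not too far from it, the argument is at least
    pi / 2. *)
Lemma rsqrt_arg_expi_le (x : R) : - (pi *+ 2) + pi / 2 < x <= pi ->
  rsqrt (arg (expi x)) <= rsqrt x + rsqrt (pi / 2).
Proof.
move=> /andP[xl xr]; have pi0 := pi_gt0 R.
have [xpi|xpi] := ltP (- pi) x.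
  by rewrite arg_expi ?xpi// lerDl rsqrt_ge0.
rewrite -expiD2pi arg_expi; last by apply/andP; split; lra.
by rewrite (le_trans (rsqrt_ltr (pi / 2) _ _ _)) ?lerDr ?rsqrt_ge0//; lra.
Qed.

Section convolution_near_one.
Variables (n : nat) (z : T).
Hypothesis arg_z : - fejer_scale n < arg z < 0.

(** The integrand of the convolution at z, as a function of the angle. *)
Let H (x : R) : R := rsqrt (arg (expi (arg z - x))) * fejerR n x.

Let H_ge0 x : 0 <= H x.
Proof. by rewrite mulr_ge0 ?rsqrt_ge0 ?fejerR_ge0. Qed.

Let measurable_H : measurable_fun setT H.
Proof.
apply: measurable_funM; last exact: measurable_fejerR.
apply: (measurableT_comp measurable_rsqrt_arg_expi).
exact: measurable_funB.
Qed.

Lemma Re_convolution_one_sided_fun :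
  @complex.Re R (convolution f (fejer n) z) =
  (2 * pi)^-1 * \int[mu]_(x in `[- pi, pi]) H x.
Proof.
rewrite /convolution /cintegral.
set I := (X in _%:C%C * Complex _ X).
rewrite /= mul0r subr0; congr (_ * _).
apply: eq_Rintegral => x _.
rewrite fejer_expi /one_sided_fun -{1}(expi_arg z) -expiD -rmorphM.
by [].
Qed.

(** The real-valued integral is 0 when the extended one is infinite, so the
    lower bound below needs this finiteness. *)
Let integral_H_lty : (\int[mu]_(x in `[(- pi)%R, pi]) (H x)%:E < +oo)%E.
Proof.
have pi0 := pi_gt0 R; have d8 := fejer_scale_le n.
have /andP[z1 z2] := arg_z.
have mq : measurable_fun setT (fun x : R => (rsqrt x)%:E).
  by apply/measurable_EFinP; exact: measurable_rsqrt.
have mqr : measurable_fun setT (fun x : R => (rsqrt (arg z - x))%:E).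
  by apply: (measurableT_comp mq); exact: measurable_funB.
have r0 (x : R) : (0 <= (rsqrt x)%:E)%E by rewrite lee_fin rsqrt_ge0.
pose c : R := 2 * n.+1%:R.
have c0 : 0 <= c by rewrite mulr_ge0.
apply: (@le_lt_trans _ _ (\int[mu]_(x in `[(- pi)%R, pi])
    (c%:E * ((rsqrt (arg z - x))%:E + (rsqrt (pi / 2))%:E)))%E).
  apply: ge0_le_integral => //.
  - by move=> x _; rewrite lee_fin.
  - by apply: measurable_funTS; exact/measurable_EFinP.
  - apply: measurable_funTS; apply: emeasurable_funM => //.
    exact: emeasurable_funD.
  - move=> x; rewrite /= in_itv/= => /andP[x1 x2].
    rewrite -EFinD -EFinM lee_fin /H mulrC.
    apply: ler_pM; rewrite ?fejerR_ge0 ?rsqrt_ge0 ?fejerR_le//.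
    by apply: rsqrt_arg_expi_le; apply/andP; split; lra.
rewrite ge0_integralZl//; last 2 first.
- by apply: measurable_funTS; exact: emeasurable_funD.
- by move=> x _; rewrite adde_ge0.
rewrite lte_mul_pinfty ?lee_fin// ge0_integralD//; last first.
  exact: measurable_funTS.
apply: lte_add_pinfty; last first.
  have muI : (mu `[(- pi)%R, pi]%classic < +oo)%E.
    by rewrite lebesgue_measure_itv/=; case: ifP => // _; rewrite -EFinB ltry.
  by rewrite integral_cst// lte_mul_pinfty.
rewrite (ge0_integral_reflect _ _ _ (fun x => (rsqrt x)%:E))//.
apply: le_lt_trans (integral_rsqrt_sym_lty (pi *+ 2) _); last by lra.
apply: ge0_subset_integral => //; first exact: measurable_funTS.
by move=> x /=; rewrite !in_itv/= => /andP[x1 x2]; apply/andP; split; lra.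
Qed.

Lemma Re_convolution_one_sided_fun_ge :
  rsqrt (fejer_scale n) / 64 <= @complex.Re R (convolution f (fejer n) z).
Proof.
have pi0 := pi_gt0 R; have d8 := fejer_scale_le n; have d0 := fejer_scale_gt0 n.
have dn := mul_fejer_scale n.
have /andP[z1 z2] := arg_z.
rewrite Re_convolution_one_sided_fun.
set d := fejer_scale n in d8 d0 dn z1 *.
(* on J both factors are bounded below: arg z - x lies in ]0, d[, and |x| is
   less than 2 d *)
pose J : set R := `](arg z - d), (arg z)[%classic.
pose c : R := rsqrt d * (n.+1%:R / 4).
have cJ : (c * d)%:E = (\int[mu]_(x in J) c%:E)%E.
  rewrite integral_cst/=; last exact: measurable_itv.
  rewrite lebesgue_measure_itv/= lte_fin.
  rewrite [X in if X then _ else _](_ : _ = true); last by lra.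
  by rewrite -EFinB -EFinM; congr (_%:E); ring.
have JH : (\int[mu]_(x in J) c%:E <= \int[mu]_(x in J) (H x)%:E)%E.
  apply: ge0_le_integral => //.
  - exact: measurable_itv.
  - by move=> x _; rewrite lee_fin !mulr_ge0 ?rsqrt_ge0.
  - by apply: measurable_funTS; exact/measurable_EFinP.
  - move=> x; rewrite /J/= in_itv/= => /andP[x1 x2]; rewrite lee_fin /c /H.
    apply: ler_pM; rewrite ?rsqrt_ge0//.
      rewrite arg_expi; last by apply/andP; split; lra.
      by apply: rsqrt_ltr; lra.
    apply: fejerR_ge; apply: (@le_trans _ _ (n.+1%:R * (2 * d))).
      by rewrite ler_wpM2l// ler_norml; apply/andP; split; lra.
    by rewrite mulrCA dn; lra.
have HH : (\int[mu]_(x in J) (H x)%:E <=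
    \int[mu]_(x in `[(- pi)%R, pi]) (H x)%:E)%E.
  apply: ge0_subset_integral => //; first exact: measurable_itv.
  - by apply: measurable_funTS; exact/measurable_EFinP.
  - by move=> x _; rewrite lee_fin.
  - by move=> x; rewrite /J/= !in_itv/= => /andP[x1 x2]; apply/andP; split; lra.
have : c * d <= \int[mu]_(x in `[- pi, pi]) H x.
  rewrite -lee_fin fineK; first by rewrite cJ (le_trans JH).
  rewrite ge0_fin_numE//; apply: integral_ge0 => x _; by rewrite lee_fin.
have -> : c * d = rsqrt d * (pi / 32).
  transitivity (rsqrt d * (n.+1%:R * d / 4)); last by rewrite dn; field.
  by rewrite /c; field.
move=> h; rewrite [leRHS]mulrC ler_pdivlMr ?mulr_gt0//; apply: le_trans h.
rewrite le_eqVlt; apply/orP; left; apply/eqP; by field.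
Qed.

End convolution_near_one.

(** The norms of f * F_n - f in L^1(w) are bounded away from 0. *)
Lemma weighted_L1_norm_convolution_sub_ge n :
  ((128 * pi)^-1%:E <=
   weighted_L1_norm w (convolution f (fejer n) \- f)%R)%E.
Proof.
have pi0 := pi_gt0 R; have d8 := fejer_scale_le n; have d0 := fejer_scale_gt0 n.
pose d := fejer_scale n; rewrite -/d in d8 d0.
pose A : set T := @arg R @^-1` `](- d), 0[%classic.
have mI : measurable (`](- d), 0[%classic : set R) by exact: measurable_itv.
have mA : measurable A.
  by rewrite -[A]setTI; exact: measurable_arg.
have muA : m A = (d / (2 * pi))%:E.
  rewrite -[A]setIT -integral_indic//.
  rewrite (ge0_integral_circle_arg (fun x => (\1_(`](- d), 0[%classic) x)%:E)).
  - rewrite integral_indic// setIidl; last first.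
      by move=> x /=; rewrite !in_itv/= => /andP[x1 x2]; apply/andP; split; lra.
    have muI : mu `](- d), 0[%classic = d%:E.
      by rewrite lebesgue_measure_itv/= lte_fin oppr_lt0 d0 -EFinB sub0r opprK.
    rewrite [X in (_ * X)%E]muI -EFinM; congr (_%:E); exact: mulrC.
  - by apply/measurable_EFinP; exact/measurable_indicP.
  - by move=> x; rewrite lee_fin.
pose c := rsqrt d / 64 * rsqrt d.
have cE (p q : R) : p != 0 -> q != 0 ->
    (128 * p)^-1 = q^-1 / 64 * (q / (2 * p)).
  by move=> p0 q0; field; rewrite p0.
have -> : (128 * pi)^-1%:E = (c%:E * m A)%E.
  rewrite muA -EFinM; congr (_%:E); rewrite /c.
  rewrite [X in _ = X * _]mulrAC -expr2 sqr_rsqrt ?ltW//.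
  by apply: cE; exact: lt0r_neq0.
apply: ge_integral_of_ge_on => //.
- by rewrite mulr_ge0 ?divr_ge0 ?rsqrt_ge0.
- by move=> z; exact: cmod_ge0.
move=> z; rewrite /A/= in_itv/= => zA.
rewrite (cmod_weight_mul _ one_sided_weight_ge1) -EFinM lee_fin /c.
have /andP[z1 z2] := zA.
apply: ler_pM; rewrite ?rsqrt_ge0 ?divr_ge0 ?rsqrt_ge0//.
  apply: (le_trans (Re_convolution_one_sided_fun_ge _ _ zA)).
  rewrite [(_ \- _) z]/= /one_sided_fun (rsqrt_le0 _ (ltW z2)) rmorph0 subr0.
  case: (convolution _ _ z) => a b /=.
  by rewrite (le_trans (ler_norm a))// -sqrtr_sqr ler_wsqrtr// lerDl sqr_ge0.
rewrite /one_sided_weight (le_trans (rsqrt_ltr (- arg z) _ _ _)) ?lerDr//; lra.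
Qed.

End counterexample.

(* The inverse of w is taken in \bar R, where 0^-1 = +oo: a bound on w^-1 forces
   w to be positive almost everywhere. *)
Theorem theorem1p4 (R : realType) :
  exists w : circle R -> R,
    [/\ forall t, 0 <= w t,
        (circle_measure R).-integrable setT (EFin \o w),
        ('N[circle_measure R]_+oo [ (fun t => ((w t)%:E)^-1) ] < +oo)%E,
        banach_function_space (weighted_L1 w) (weighted_L1_norm w) /\
        separable (weighted_L1 w) (weighted_L1_norm w) &
        exists f : circle R -> R[i],
          weighted_L1 w f /\
          ~ (weighted_L1_norm w (convolution f (fejer n) \- f) @[n --> \oo]
               --> 0%E)].
Proof.
have mw := @measurable_one_sided_weight R.
have w1 := @one_sided_weight_ge1 R.
have iw := integrable_one_sided_weight.
exists one_sided_weight; split.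
- by move=> t; rewrite (le_trans ler01).
- exact: iw.
- exact: ess_sup_inv_one_sided_weight.
- split; first exact: banach_function_space_weighted_L1.
  by apply: separable_weighted_L1 => // t; rewrite (lt_le_trans ltr01).
- exists one_sided_fun; split; first exact: weighted_L1_one_sided_fun.
  move=> cvg0.
  have : ((128 * pi)^-1%:E <= 0 :> \bar R)%E.
    apply: (cvge_to_ge cvg0); apply: nearW => n.
    exact: weighted_L1_norm_convolution_sub_ge.
  by rewrite lee_fin leNgt invr_gt0 mulr_gt0 ?pi_gt0.
Qed.
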